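(* Let $k\ge2$ be even, let $\ell$ be an integer with $k/2\le\ell\le n-k/2$, and let $\beta\in(0,1)$. Let $\Phi$ be a uniformly random $k$-XOR formula on $n$ variables with $m$ constraints. If \[m\ge\frac{4e^2\binom{n}{k}\log\binom{n}{\ell}}{\beta^2 d_\ell},\qquad d_\ell=\binom{n-\ell}{k/2}\binom{\ell}{k/2},\] then with probability at least $1-3\binom{n}{\ell}^{-1}$ over $\Phi$, \[\frac m2+\frac{1}{2d_\ell}\binom{n}{k}\|\mathbf{M}\|\le\frac m2(1+\beta),\] where the left-hand side is, for every formula $\Phi$, an upper bound on $\max_{x\in\{\pm1\}^n}P_\Phi(x)$; hence $\|\mathbf{M}\|$ certifies $P_\Phi(x)\le\frac m2(1+\beta)$ for all $x\in\{\pm1\}^n$.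
   Context: A $k$-XOR formula $\Phi$ with $m$ constraints on variables $x\in\{\pm1\}^n$ consists of subsets $U_1,\ldots,U_m\subseteq[n]$ with $|U_i|=k$ and signs $b_1,\ldots,b_m\in\{\pm1\}$; constraint $i$ is satisfied by $x$ if $\prod_{j\in U_i}x_j=b_i$, and $P_\Phi(x)$ is the number of satisfied constraints. In a uniformly random formula the $U_i$ are independent and uniform among the $\binom nk$ $k$-subsets and the $b_i$ are independent uniform signs. $\mathbf{M}=\sum_{i=1}^m\mathbf{M}^{(i)}$ is the $\binom n\ell\times\binom n\ell$ matrix indexed by $\ell$-subsets $S,T$ of $[n]$, with $\mathbf{M}^{(i)}_{S,T}=b_i$ if $S\triangle T=U_i$ and $0$ otherwise. $\|\mathbf{M}\|$ is the operator norm. *)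

(* Defs.v *)
From HB Require Import structures.
From mathcomp Require Import all_boot all_order all_algebra.
From mathcomp Require Import all_classical all_reals all_analysis.
Set Implicit Arguments. Unset Strict Implicit. Unset Printing Implicit Defensive.
Import Order.TTheory GRing.Theory Num.Theory.
Local Open Scope ring_scope.

Definition ksub (n k : nat) := {A : {set 'I_n} | #|A| == k}.

Definition sgnb {R : ringType} (b : bool) : R := if b then 1 else -1.

Definition formula (n k m : nat) := {ffun 'I_m -> (ksub n k * bool)%type}.

Definition sdiff (n : nat) (S T : {set 'I_n}) : {set 'I_n} := (S :\: T) :|: (T :\: S).

Definition Psat {R : ringType} (n k m : nat) (Phi : formula n k m) (x : 'I_n -> R) : nat :=
  #|[set i : 'I_m | \prod_(j in val (Phi i).1) x j == sgnb (Phi i).2]|.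

Definition Mmat {R : ringType} (n k m l : nat) (Phi : formula n k m)
  (S T : ksub n l) : R :=
  \sum_(i < m) (if sdiff (val S) (val T) == val (Phi i).1 then sgnb (Phi i).2 else 0).

Definition opnorm {R : realType} {I : finType} (M : I -> I -> R) : R :=
  sup [set r : R | exists v : I -> R,
        \sum_(t : I) v t ^+ 2 <= 1 /\
        r = Num.sqrt (\sum_(s : I) (\sum_(t : I) M s t * v t) ^+ 2)].

Definition unif_prob {R : realType} {T : finType} (E : {set T}) : R :=
  #|E|%:R / #|T|%:R.

(* Main.v *)
(** Let q = d / C(n,k) be the probability that a given l-subset has an edge in
    the matching of a random constraint.  Expand tr M^p over words of
    constraints.  The signs kill every word in which some letter occurs an odd
    number of times, and for an even word exposing the constraints in order of
    first appearance bounds the expected number of walks from a vertex by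
    q ^ (number of distinct letters).  This is exactly the contribution of the
    word to E X^p, where X is a sum of m independent steps equal to 0 with
    probability 1 - q and to 1 or -1 with probability q / 2 each.  Hence
    E tr M^p <= C(n,l) E X^p; since ||M||^p <= tr M^p for even p, comparing the
    cosh series gives
      P(||M|| > t) exp(x t) <= 2 C(n,l) exp(m q (cosh x - 1)),
    which is used with t = beta m q and x = beta / 2.
    The certificate is the quadratic form of M at the normalised character
    S |-> prod_(j in S) x_j. *)
Require Import Defs.
From HB Require Import structures.
From mathcomp Require Import all_boot all_order all_algebra.
From mathcomp Require Import all_classical all_reals all_analysis.
From mathcomp Require Import ring lra zify.
Set Implicit Arguments. Unset Strict Implicit. Unset Printing Implicit Defensive.
Import Order.TTheory GRing.Theory Num.Theory.
Import numFieldNormedType.Exports.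
Local Open Scope ring_scope.

(** * Powers of symmetric matrices, and cosh *)

(** Lagrange's identity: the double sum of squares of the 2 by 2 minors of [(u, v)] is nonnegative
    and equals twice the difference of the two sides. *)
Lemma sum_cauchy_schwarz (R : realFieldType) (I : finType) (u v : I -> R) :
  (\sum_s u s * v s) ^+ 2 <= (\sum_s u s ^+ 2) * (\sum_s v s ^+ 2).
Proof.
have : 0 <= \sum_s \sum_t (u s * v t - u t * v s) ^+ 2.
  by apply: sumr_ge0 => s _; apply: sumr_ge0 => t _; exact: sqr_ge0.
have E s t : (u s * v t - u t * v s) ^+ 2 =
    u s ^+ 2 * v t ^+ 2 - (u s * v s * (u t * v t)) *+ 2 + v s ^+ 2 * u t ^+ 2.
  by ring.
under eq_bigr => s _ do under eq_bigr => t _ do rewrite E.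
under eq_bigr => s _ do rewrite !big_split /= sumrN sumrMnl -!mulr_sumr.
rewrite !big_split /= sumrN sumrMnl -!mulr_suml expr2.
set a := \sum_s u s ^+ 2; set b := \sum_s v s ^+ 2; set c := \sum_s _ * _.
lra.
Qed.

Section Powers.
Variables (R : realFieldType) (I : finType).
Implicit Types (M : I -> I -> R) (v : I -> R).

Definition mvec M v (s : I) : R := \sum_t M s t * v t.

Fixpoint mpow M (p : nat) (s t : I) : R :=
  if p is p'.+1 then \sum_u mpow M p' s u * M u t else (s == t)%:R.

Lemma mvec_sym M u v : (forall s t, M s t = M t s) ->
  \sum_s mvec M u s * v s = \sum_s u s * mvec M v s.
Proof.
move=> Ms; rewrite /mvec.
under eq_bigr => s _ do rewrite mulr_suml.
under [RHS]eq_bigr => s _ do rewrite mulr_sumr.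
rewrite exchange_big; apply: eq_bigr => s _; apply: eq_bigr => t _.
by rewrite Ms; ring.
Qed.

Lemma sum_delta (s : I) (F : I -> R) : \sum_t (s == t)%:R * F t = F s.
Proof.
rewrite (bigD1 s) //= eqxx mul1r big1 ?addr0 // => t.
by rewrite eq_sym => /negPf ->; rewrite mul0r.
Qed.

Lemma mpow_add M p q s t :
  mpow M (p + q) s t = \sum_u mpow M p s u * mpow M q u t.
Proof.
elim: q t => [|q IH] t.
  rewrite addn0 /=; under eq_bigr => u _ do rewrite mulrC eq_sym.
  by rewrite sum_delta.
rewrite addnS /=; under eq_bigr => u _ do rewrite IH mulr_suml.
under [RHS]eq_bigr => u _ do rewrite mulr_sumr.
rewrite exchange_big; apply: eq_bigr => u _; apply: eq_bigr => w _.
by rewrite mulrA.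
Qed.

Lemma mpow1 M s t : mpow M 1 s t = M s t.
Proof. by rewrite /= sum_delta. Qed.

Lemma mpow_sym M p s t : (forall s t, M s t = M t s) ->
  mpow M p s t = mpow M p t s.
Proof.
move=> Ms; elim: p s t => [|p IH] s t; first by rewrite /= eq_sym.
rewrite -[in RHS]add1n mpow_add /=; apply: eq_bigr => u _.
by rewrite -/(mpow M 1 t u) mpow1 IH Ms mulrC.
Qed.

Lemma iter_mvec M v p s : iter p (mvec M) v s = \sum_t mpow M p s t * v t.
Proof.
elim: p s => [|p IH] s; first by rewrite /= sum_delta.
rewrite -add1n [RHS](eq_bigr (fun t => \sum_u M s u * mpow M p u t * v t)).
  rewrite exchange_big iterD /= {1}/mvec; apply: eq_bigr => u _.
  by rewrite IH mulr_sumr; apply: eq_bigr => t _; rewrite mulrA.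
move=> t _; rewrite mpow_add mulr_suml; apply: eq_bigr => u _.
by rewrite mpow1.
Qed.

(** Cauchy-Schwarz bounds each squared entry of $M^p v$ by the squared norm of a row of $M^p$, which
    by symmetry is a diagonal entry of $M^{2p}$. *)
Lemma sqnorm_iter_le_trace M v p : (forall s t, M s t = M t s) ->
  \sum_t v t ^+ 2 <= 1 ->
  \sum_s iter p (mvec M) v s ^+ 2 <= \sum_s mpow M (p + p) s s.
Proof.
move=> Ms v1; apply: ler_sum => s _.
rewrite iter_mvec (le_trans (sum_cauchy_schwarz _ _)) // mpow_add.
under [leRHS]eq_bigr => u _ do rewrite (mpow_sym _ u) // -expr2.
by apply: ler_piMr => //; apply: sumr_ge0 => t _; exact: sqr_ge0.
Qed.

(* The sequence [|M^p v|^2] is log-convex by Cauchy-Schwarz, since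
   [|M^(p+1) v|^2 = <M^p v, M^(p+2) v>]; as [|v| <= 1] this gives
   [|M v|^2 |M^p v|^2 <= |M^(p+1) v|^2], without any spectral theorem. *)
Lemma sqnorm_exp_le_trace M v p : (forall s t, M s t = M t s) ->
  \sum_t v t ^+ 2 <= 1 ->
  (\sum_s mvec M v s ^+ 2) ^+ p.+1 <= \sum_s mpow M (p.+1 + p.+1) s s.
Proof.
move=> Ms v1; apply: le_trans (sqnorm_iter_le_trace p.+1 Ms v1).
pose B q := \sum_s iter q (mvec M) v s ^+ 2.
have B0 q : 0 <= B q by apply: sumr_ge0 => s _; exact: sqr_ge0.
have logconvex q : B q.+1 ^+ 2 <= B q * B q.+2.
  suff -> : B q.+1 = \sum_s iter q (mvec M) v s * iter q.+2 (mvec M) v s.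
    exact: sum_cauchy_schwarz.
  rewrite [RHS](_ : _ =
    \sum_s iter q (mvec M) v s * mvec M (iter q.+1 (mvec M) v) s) //.
  by rewrite -mvec_sym //; apply: eq_bigr => s _; rewrite expr2.
have step q : B 1%N * B q <= B q.+1.
  elim: q => [|q IH]; first by rewrite ler_piMr.
  have [/eqP Bq|Bq] := boolP (B q.+1 == 0); first by rewrite Bq mulr0.
  have Bq1 : 0 < B q.+1 by rewrite lt_def Bq B0.
  have Bq0 : 0 < B q.
    rewrite lt_def B0 andbT; apply: contraTneq (logconvex q) => ->.
    by rewrite mul0r -ltNge exprn_gt0.
  rewrite -(ler_pM2l Bq0) (le_trans _ (logconvex q)) // expr2 mulrCA mulrA.
  by rewrite ler_wpM2r.
rewrite -/(B p.+1) -/(B 1%N); elim: p => [|p IH]; first by rewrite expr1.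
by rewrite exprS (le_trans _ (step _)) // ler_wpM2l.
Qed.

(** * Sums over words of fixed length, and the noncommutative expansion of a power of a sum *)

Fixpoint wsum (J : finType) (p : nat) (F : seq J -> R) : R :=
  if p is p'.+1 then \sum_i wsum p' (fun w => F (i :: w)) else F [::].

Lemma eq_wsum (J : finType) p (F G : seq J -> R) :
  F =1 G -> wsum p F = wsum p G.
Proof.
elim: p F G => [|p IH] F G FG /=; first exact: FG.
by apply: eq_bigr => i _; apply: IH => w; exact: FG.
Qed.

Lemma ler_wsum (J : finType) p (F G : seq J -> R) :
  (forall w, F w <= G w) -> wsum p F <= wsum p G.
Proof.
elim: p F G => [|p IH] F G FG /=; first exact: FG.
by apply: ler_sum => i _; apply: IH => w; exact: FG.
Qed.

Lemma wsum_mulr (J : finType) p (F : seq J -> R) a :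
  wsum p F * a = wsum p (fun w => F w * a).
Proof.
elim: p F => [//|p IH] F /=.
by rewrite mulr_suml; apply: eq_bigr => i _; exact: IH.
Qed.

Lemma exchange_wsum (J : finType) p (K : finType) (F : K -> seq J -> R) :
  \sum_k wsum p (F k) = wsum p (fun w => \sum_k F k w).
Proof.
elim: p F => [//|p IH] F /=.
by rewrite exchange_big; apply: eq_bigr => i _; exact: IH.
Qed.

Lemma exp_sum_wsum (J : finType) p (x : J -> R) :
  (\sum_i x i) ^+ p = wsum p (fun w => \prod_(i <- w) x i).
Proof.
elim: p => [|p IH] /=; first by rewrite big_nil.
rewrite exprSr IH mulr_sumr; apply: eq_bigr => i _.
by rewrite wsum_mulr; apply: eq_wsum => w; rewrite big_cons mulrC.
Qed.

(* Words are read from right to left: the head letter is the last factor. *)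
Fixpoint wpow (J : finType) (M : J -> I -> I -> R) (w : seq J) (s t : I) : R :=
  if w is i :: w' then \sum_u wpow M w' s u * M i u t else (s == t)%:R.

Lemma mpow_wsum (J : finType) (M : J -> I -> I -> R) p s t :
  mpow (fun s t => \sum_i M i s t) p s t = wsum p (fun w => wpow M w s t).
Proof.
elim: p t => [//|p IH] t /=.
under eq_bigr => u _ do rewrite IH mulr_sumr.
rewrite exchange_big; apply: eq_bigr => i _ /=.
under eq_bigr => u _ do rewrite wsum_mulr.
by rewrite exchange_wsum.
Qed.

Lemma eq_wpow (J : finType) (M M' : J -> I -> I -> R) w s t :
  (forall i, i \in w -> forall s t, M i s t = M' i s t) ->
  wpow M w s t = wpow M' w s t.
Proof.
elim: w t => [//|i w IH] t MM' /=; apply: eq_bigr => u _.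
rewrite MM' ?mem_head // IH // => j jw; apply: MM'.
by rewrite inE jw orbT.
Qed.

Lemma wpow_flip (J : finType) (M M' : J -> I -> I -> R) i w s t :
  (forall j s t, M' j s t = (-1) ^+ (j == i) * M j s t) ->
  wpow M' w s t = (-1) ^+ (count_mem i w) * wpow M w s t.
Proof.
move=> MM'; elim: w t => [|j w IH] t /=; first by rewrite mul1r.
rewrite mulr_sumr; apply: eq_bigr => u _.
by rewrite IH MM' exprD; ring.
Qed.

End Powers.

(** * Comparison and estimation of cosh *)

Section Cosh.
Variables (R : realType).

Lemma expR_series_even (x : R) n :
  series (exp_coeff x) n + series (exp_coeff (- x)) n =
  \sum_(0 <= p < n) (if odd p then 0 else (p`!%:R)^-1 * x ^+ p *+ 2).
Proof.
rewrite /series /= -big_split /=; apply: eq_bigr => p _.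
rewrite !exp_coeffE exprNn -signr_odd.
by case: (odd p) => /=; rewrite ?expr1 ?expr0 ?mulr2n; ring.
Qed.

Lemma cvg_cosh_series (x : R) :
  (series (exp_coeff x) n + series (exp_coeff (- x)) n @[n --> \oo]
    --> expR x + expR (- x))%classic.
Proof. by apply: cvgD; exact: is_cvg_series_exp_coeff. Qed.

(** In the series of $e^y+e^{-y}$ the odd terms cancel and the even coefficients are nonnegative, so
    moment bounds add up on partial sums and pass to the limit. *)
Lemma cosh_le_of_even_moments (T : finType) (c x : T -> R) (P t : R) :
  (forall r, P * t ^+ (r + r) <= \sum_o c o * x o ^+ (r + r)) ->
  P * (expR t + expR (- t)) <= \sum_o c o * (expR (x o) + expR (- x o)).
Proof.
move=> H.
have cl : (P * (series (exp_coeff t) n + series (exp_coeff (- t)) n)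
    @[n --> \oo] --> P * (expR t + expR (- t)))%classic.
  by apply: cvgM; [exact: cvg_cst | exact: cvg_cosh_series].
have cr : (\sum_o c o * (series (exp_coeff (x o)) n
    + series (exp_coeff (- x o)) n) @[n --> \oo]
    --> \sum_o c o * (expR (x o) + expR (- x o)))%classic.
  apply: (@cvg_big _ _ +%R) => [|o _]; first by exact: add_continuous.
  by apply: cvgM; [exact: cvg_cst | exact: cvg_cosh_series].
apply: ler_cvg_to cl cr _; apply: nearW => n.
rewrite /= expR_series_even mulr_sumr.
under eq_bigr => o _ do rewrite expR_series_even mulr_sumr.
rewrite exchange_big; apply: ler_sum => p _ /=; case: ifPn => [_|ep].
  by rewrite mulr0 big1 // => o _; rewrite mulr0.
rewrite -(even_halfK ep) -addnn.
set f := (_ `!)%:R^-1; have f0 : 0 <= f by rewrite invr_ge0 ler0n.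
rewrite (_ : P * _ = (f *+ 2) * (P * t ^+ (p./2 + p./2))); last by rewrite !mulr2n; ring.
apply: le_trans (ler_wpM2l _ (H _)) _; first by rewrite mulrn_wge0.
rewrite mulr_sumr le_eqVlt; apply/orP; left; apply/eqP; apply: eq_bigr => o _.
by rewrite !mulr2n; ring.
Qed.

(** From $e^y\ge1+y$ one gets $e^x\le1/(1-x)$ and $e^{-x}\le1/(1+x)$; these two bounds sum to
    exactly the right-hand side. *)
Lemma cosh_le (x : R) : 0 <= x < 1 ->
  expR x + expR (- x) <= 2 + 2 * x ^+ 2 / (1 - x ^+ 2).
Proof.
move=> /andP[x0 x1].
have h1 : expR x <= (1 - x)^-1.
  rewrite -[x in expR x]opprK expRN lef_pV2 ?posrE ?expR_gt0 ?subr_gt0 //.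
  exact: expR_ge1Dx.
have h2 : expR (- x) <= (1 + x)^-1.
  rewrite expRN lef_pV2 ?posrE ?expR_gt0 //; last by lra.
  exact: expR_ge1Dx.
apply: le_trans (lerD h1 h2) _; rewrite le_eqVlt; apply/orP; left; apply/eqP.
field; repeat (apply/andP; split); rewrite ?subr_eq0; nra.
Qed.
End Cosh.

(** * Counting symmetric differences *)

Section SymmetricDifference.

(** A set [S] corresponds bijectively to the pair of its traces on [A] and on the complement of
    [A]. *)
Lemma card_split (T : finType) (A : {set T}) a b :
  #|[set S : {set T} | (#|S :&: A| == a) && (#|S :\: A| == b)]| =
  ('C(#|A|, a) * 'C(#|~: A|, b))%N.
Proof.
rewrite -!cards_draws -cardsX; set X := finset.setX _ _.
have restr (B C : {set T}) : B \subset A -> C \subset ~: A ->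
    ((B :|: C) :&: A = B) * ((B :|: C) :\: A = C).
  move=> /fintype.subsetP BA /fintype.subsetP CA; split; apply/setP => x; rewrite !inE.
    have [xB|_] /= := boolP (x \in B); first exact: BA.
    by apply/negP => /andP[/CA]; rewrite !inE => /negP.
  have [/BA xA|_] := boolP (x \in B).
    rewrite xA /=; apply/esym/negbTE/negP => /CA.
    by rewrite !inE xA.
  have [/CA|_] := boolP (x \in C); last by rewrite andbF.
  by rewrite !inE => ->.
rewrite -(card_in_imset (f := fun p : {set T} * {set T} => p.1 :|: p.2) (D := X)).
  apply: eq_card => S; rewrite inE; apply/idP/imsetP => [/andP[Sa Sb]|].
    exists (S :&: A, S :\: A); last by rewrite /= finset.setID.
    by rewrite !inE /= finset.subsetIr Sa Sb finset.setDE finset.subsetIr.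
  move=> [[B C]]; rewrite !inE /= => /andP[/andP[BA Ba] /andP[CA Cb]] ->.
  by rewrite !restr // Ba.
move=> [B C] [B' C']; rewrite !inE /=.
move=> /andP[/andP[BA _] /andP[CA _]] /andP[/andP[BA' _] /andP[CA' _]] E.
have := congr1 (fun S : {set T} => S :&: A) E.
have := congr1 (fun S : {set T} => S :\: A) E.
by rewrite /= !restr // => -> ->.
Qed.

Variable n : nat.
Implicit Types S T U V : {set 'I_n}.

Lemma in_sdiff S T x : (x \in sdiff S T) = (x \in S) (+) (x \in T).
Proof. by rewrite !inE; do 2 case: (x \in _). Qed.

Lemma sdiffC S T : sdiff S T = sdiff T S.
Proof. by rewrite /sdiff finset.setUC. Qed.

Lemma sdiffK S T : sdiff S (sdiff S T) = T.
Proof. by apply/setP => x; rewrite !in_sdiff addKb. Qed.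

Lemma sdiff_eq S T V : (sdiff S T == V) = (T == sdiff S V).
Proof. by apply/eqP/eqP => [<-|->]; rewrite sdiffK. Qed.

Lemma card_sdiff S T : #|sdiff S T| = (#|S :\: T| + #|T :\: S|)%N.
Proof.
rewrite /sdiff cardsU [X in (_ - X)%N](_ : _ = 0%N) ?subn0 //.
by apply/eqP; rewrite cards_eq0; apply/eqP/setP => x; rewrite !inE;
  do 2 case: (x \in _).
Qed.

Lemma card_setC_ord V : #|~: V| = (n - #|V|)%N.
Proof. by rewrite [LHS]cardsCs finset.setCK card_ord. Qed.

Variable R : realFieldType.

Lemma sum_ksub l (F : {set 'I_n} -> R) :
  \sum_(T : ksub n l) F (val T) = \sum_(T : {set 'I_n} | #|T| == l) F T.
Proof.
rewrite [RHS](reindex_omap (val : ksub n l -> _) insub) /=.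
  by apply: eq_bigl => T; rewrite valK eqxx (valP T).
by move=> T Tl; rewrite insubT.
Qed.

Lemma card_ksub l : #|{: ksub n l}| = 'C(n, l).
Proof. by rewrite card_sig -[in RHS](card_ord n) -card_draws cardsE. Qed.

Lemma sum_ksub_eq l V :
  \sum_(T : ksub n l) (val T == V)%:R = (#|V| == l)%:R :> R.
Proof.
rewrite (sum_ksub l (fun T => (T == V)%:R)).
have [Vl|Vl] := boolP (#|V| == l).
  rewrite (bigD1 V) //= eqxx big1 ?addr0 // => T /andP[_ /negPf ->] //.
rewrite big1 // => T Tl; case: eqP => // TV.
by rewrite -TV Tl in Vl.
Qed.

Lemma sum_ksub_card l (P : pred {set 'I_n}) :
  \sum_(T : ksub n l) (P (val T))%:R =
  #|[set T : {set 'I_n} | (#|T| == l) && P T]|%:R :> R.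
Proof.
rewrite (sum_ksub l (fun T => (P T)%:R)) -sum1dep_card natr_sum.
by rewrite big_mkcondr; apply: eq_bigr => T _; case: (P T).
Qed.

(** Two [l]-sets differ in [k] points exactly when each has [k/2] points outside the other, so a
    neighbour of [U] keeps [l - k/2] points of [U] and adds [k/2] new ones. *)
Lemma sum_neighbors l k (U : ksub n l) : ~~ odd k -> (k %/ 2 <= l)%N ->
  \sum_(T : ksub n l) (#|sdiff (val U) (val T)| == k)%:R =
  ('C(n - l, k %/ 2) * 'C(l, k %/ 2))%N%:R :> R.
Proof.
move=> ek kl; rewrite (sum_ksub_card l (fun T => #|sdiff (val U) T| == k)).
have Ul : #|val U| = l by exact/eqP/(valP U).
have <- : ('C(#|val U|, l - k %/ 2) * 'C(#|~: val U|, k %/ 2) =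
    'C(n - l, k %/ 2) * 'C(l, k %/ 2))%N.
  by rewrite card_setC_ord Ul mulnC bin_sub.
rewrite -card_split; congr (_%:R); apply: eq_card => T; rewrite !inE.
rewrite card_sdiff.
have := cardsID (val U) T; have := cardsID T (val U); rewrite finset.setIC Ul.
move: #|_ :&: _| #|_ :\: _| #|_ :\: _| => a b c.
move: #|T| (even_halfK ek) kl; rewrite divn2 -muln2.
by move: (k./2) => h c' <-; lia.
Qed.

(** [S] determines [T] as its symmetric difference with [V], and this [T] has size [l] exactly when
    [S] contains half of [V]. *)
Lemma sum_pairs l k (V : ksub n k) : ~~ odd k -> (k %/ 2 <= l)%N ->
  \sum_(S : ksub n l) \sum_(T : ksub n l) (sdiff (val S) (val T) == val V)%:R =
  ('C(k, k %/ 2) * 'C(n - k, l - k %/ 2))%N%:R :> R.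
Proof.
move=> ek kl.
under eq_bigr => S _ do under eq_bigr => T _ do rewrite sdiff_eq.
under eq_bigr => S _ do rewrite sum_ksub_eq.
rewrite (sum_ksub_card l (fun S => #|sdiff S (val V)| == l)).
have Vk : #|val V| = k by exact/eqP/(valP V).
have <- : ('C(#|val V|, k %/ 2) * 'C(#|~: val V|, l - k %/ 2) =
    'C(k, k %/ 2) * 'C(n - k, l - k %/ 2))%N.
  by rewrite card_setC_ord Vk.
rewrite -card_split; congr (_%:R); apply: eq_card => T; rewrite !inE.
rewrite card_sdiff.
have := cardsID (val V) T; have := cardsID T (val V); rewrite finset.setIC Vk.
move: #|_ :&: _| #|_ :\: _| #|_ :\: _| => a b c.
move: #|T| (even_halfK ek) kl; rewrite divn2 -muln2.
by move: (k./2) => h c' <-; lia.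
Qed.

(** Both sides count triples [(V, S, T)] with [V] the symmetric difference of [S] and [T], grouped
    by [V] on the left and by [S] on the right. *)
Lemma double_count l k : ~~ odd k -> (k %/ 2 <= l)%N ->
  'C(n, k)%:R * ('C(k, k %/ 2) * 'C(n - k, l - k %/ 2))%N%:R =
   'C(n, l)%:R * ('C(n - l, k %/ 2) * 'C(l, k %/ 2))%N%:R :> R.
Proof.
move=> ek kl; transitivity (\sum_(V : ksub n k) \sum_(S : ksub n l)
    \sum_(T : ksub n l) (sdiff (val S) (val T) == val V)%:R : R).
  under eq_bigr => V _ do rewrite sum_pairs //.
  by rewrite sumr_const card_ksub mulr_natl.
rewrite exchange_big; under eq_bigr => S _ do rewrite exchange_big.
under eq_bigr => S _ do under eq_bigr => T _ do
  under eq_bigr => V _ do rewrite eq_sym.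
under eq_bigr => S _ do under eq_bigr => T _ do rewrite sum_ksub_eq.
under eq_bigr => S _ do rewrite sum_neighbors //.
by rewrite sumr_const card_ksub mulr_natl.
Qed.

End SymmetricDifference.

(** * Moments of the random matrix *)

Section Resampling.
Variables (I A : finType).

Definition upd (f : {ffun I -> A}) (i : I) (a : A) : {ffun I -> A} :=
  [ffun j => if j == i then a else f j].

Lemma upd_upd f i a b : upd (upd f i a) i b = upd f i b.
Proof. by apply/ffunP => j; rewrite !ffunE; case: eqP. Qed.

Lemma upd_id f i : upd f i (f i) = f.
Proof. by apply/ffunP => j; rewrite ffunE; case: eqP => [->|]. Qed.

(* Swapping the [i]-th coordinate of [f] with [a] is an involution on pairs. *)
Lemma sum_resample (R : realFieldType) (i : I) (F : {ffun I -> A} -> R) :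
  \sum_f \sum_a F (upd f i a) = #|A|%:R * \sum_f F f.
Proof.
rewrite (pair_bigA _ (fun f a => F (upd f i a))) /=.
pose h (p : {ffun I -> A} * A) := (upd p.1 i p.2, p.1 i).
have hK : involutive h.
  by move=> [f a]; rewrite /h /= upd_upd upd_id ffunE eqxx.
rewrite (reindex_inj (inv_inj hK)) /=.
under eq_bigr => p _ do rewrite upd_upd upd_id.
rewrite -(pair_bigA _ (fun f a => F f)) mulr_sumr; apply: eq_bigr => f _ /=.
by rewrite sumr_const mulr_natl.
Qed.

End Resampling.

Section RandomWords.
Variables (R : realFieldType) (n k l m : nat).
Implicit Types (Phi : formula n k m) (w : seq 'I_m).

Local Notation A := (ksub n k * bool)%type.
Local Notation K := ('C(n, k)%:R : R).
Local Notation d := (('C(n - l, k %/ 2) * 'C(l, k %/ 2))%N%:R : R).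

Definition cmat (a : A) (S T : ksub n l) : R :=
  if sdiff (val S) (val T) == val a.1 then sgnb a.2 else 0.

Lemma normr_cmat a S T :
  `|cmat a S T| = (sdiff (val S) (val T) == val a.1)%:R.
Proof.
rewrite /cmat /sgnb; case: eqP; last by rewrite normr0.
by case: a.2; rewrite ?normrN normr1.
Qed.

Lemma cmat_sym a S T : cmat a S T = cmat a T S.
Proof. by rewrite /cmat sdiffC. Qed.

Lemma row_cmat_le1 a S : \sum_T `|cmat a S T| <= 1.
Proof.
under eq_bigr => T _ do rewrite normr_cmat sdiff_eq.
by rewrite sum_ksub_eq lern1 leq_b1.
Qed.

Hypotheses (ek : ~~ odd k) (kl : (k %/ 2 <= l)%N) (kn : (k <= n)%N).

(** Each of the [d] neighbours of [S] is reached by a single constraint set; the factor 2 counts its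
    signs. *)
Lemma sum_cmat S : \sum_(a : A) \sum_T `|cmat a S T| = 2 * d.
Proof.
rewrite exchange_big /= -(sum_neighbors R S ek kl) mulr_sumr.
apply: eq_bigr => T _; under eq_bigr => a _ do rewrite normr_cmat eq_sym.
rewrite -(pair_bigA _ (fun V b => (val V == sdiff (val S) (val T))%:R)) /=.
under eq_bigr => V _ do rewrite sumr_const card_bool.
by rewrite sumrMnl sum_ksub_eq mulr_natl.
Qed.

Lemma binR_gt0 : 0 < K.
Proof. by rewrite ltr0n bin_gt0. Qed.

Lemma card_constraint : #|{: A}|%:R = 2 * K :> R.
Proof. by rewrite card_prod card_ksub card_bool natrM mulrC. Qed.

Lemma card_constraint_gt0 : 0 < #|{: A}|%:R :> R.
Proof. by rewrite card_constraint mulr_gt0 // binR_gt0. Qed.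

Let q := d / K.

(* The vertex reached so far is independent of a constraint not met before, so
   that constraint extends the walk with probability [q]; a constraint already
   met extends it in at most one way. *)
Lemma sum_wpow_norm w S :
  \sum_(Phi : formula n k m) \sum_T `|wpow (fun i => cmat (Phi i)) w S T| <=
  #|{: formula n k m}|%:R * q ^+ size (undup w).
Proof.
elim: w => [|i w IH] /=.
  rewrite mulr1 -[#|_|%:R]mul1r mulr_natr -sumr_const; apply: ler_sum => Phi _.
  under eq_bigr => T _ do rewrite normr_nat -[_%:R]mulr1.
  by rewrite sum_delta.
have row Phi : \sum_T `|\sum_U wpow (fun i => cmat (Phi i)) w S U *
    cmat (Phi i) U T| <=
    \sum_U `|wpow (fun i => cmat (Phi i)) w S U| *
       \sum_T `|cmat (Phi i) U T|.
  under [leRHS]eq_bigr => U _ do rewrite mulr_sumr.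
  rewrite exchange_big; apply: ler_sum => T _ /=.
  apply: le_trans (ler_norm_sum _ _ _) _.
  by apply: ler_sum => U _; rewrite normrM.
apply: le_trans (ler_sum _ (fun Phi _ => row Phi)) _.
have [iw|iw] := boolP (i \in w).
  apply: le_trans IH; apply: ler_sum => Phi _; apply: ler_sum => U _.
  by rewrite ler_piMr // row_cmat_le1.
(* Coordinate [i] is redrawn as an independent [a]; the walk along [w] does not see the change
   because [i] does not occur in [w]. *)
rewrite -(ler_pM2l card_constraint_gt0) -(sum_resample i) /= exprS.
rewrite [leRHS](_ : _ = 2 * d *
  (#|{: formula n k m}|%:R * q ^+ size (undup w))); last first.
  by rewrite card_constraint /q; field; rewrite gt_eqF ?binR_gt0.
apply: le_trans (ler_wpM2l _ IH); last by rewrite mulr_ge0 ?ler0n.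
rewrite mulr_sumr; apply: ler_sum => Phi _.
rewrite exchange_big /= mulr_sumr; apply: ler_sum => U _.
rewrite mulrC -(sum_cmat U) mulr_sumr; apply: ler_sum => a _.
rewrite ffunE eqxx ler_wpM2r ?sumr_ge0 // le_eqVlt; apply/orP; left; apply/eqP.
congr `|_|; apply: eq_wpow => j jw S' T'; rewrite ffunE ifN //.
by apply: contraNneq iw => <-.
Qed.

(** Flipping the sign of constraint [i] is a bijection on formulas that negates every summand. *)
Lemma sum_wpow_odd w i S T : odd (count_mem i w) ->
  \sum_(Phi : formula n k m) wpow (fun i => cmat (Phi i)) w S T = 0.
Proof.
move=> ow; pose flip Phi : formula n k m := upd Phi i ((Phi i).1, ~~ (Phi i).2).
have flipK : involutive flip.
  move=> Phi; apply/ffunP => j; rewrite !ffunE eqxx.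
  by case: eqP => [->|//]; case: (Phi i) => V b /=; rewrite negbK.
set s := LHS; suff : s = - s by lra.
rewrite {1}/s (reindex_inj (inv_inj flipK)) -sumrN; apply: eq_bigr => Phi _.
rewrite (@wpow_flip _ _ _ (fun i => cmat (Phi i)) _ i).
  by rewrite -signr_odd ow expr1 mulN1r.
move=> j S' T'; rewrite ffunE /cmat /sgnb; case: (eqVneq j i) => [->|_] /=.
  by rewrite expr1; case: (Phi i) => V [] /=; case: ifP => _;
    rewrite ?mulr0 ?mulN1r ?opprK.
by rewrite mul1r.
Qed.

Definition even_word w := all (fun i => ~~ odd (count_mem i w)) w.

Lemma sum_wpow_le w S :
  \sum_(Phi : formula n k m) wpow (fun i => cmat (Phi i)) w S S <=
  #|{: formula n k m}|%:R * (if even_word w then q ^+ size (undup w) else 0).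
Proof.
case: ifPn => [_|/allPn[i iw]]; last first.
  by rewrite negbK mulr0 => /sum_wpow_odd ->.
apply: le_trans (sum_wpow_norm w S); apply: ler_sum => Phi _.
apply: le_trans (ler_norm _) _; rewrite [leRHS](bigD1 S) //= lerDl.
by rewrite sumr_ge0.
Qed.

End RandomWords.

(** * The scalar comparison walk with independent steps in {-1, 0, 1} *)

Section ScalarWalk.
Variables (R : realType) (m : nat) (q : R).

(** The first bit says whether the step is nonzero, the second is a fair sign; both outcomes with
    first bit [false] give step 0, hence the common factor 1/2. *)
Definition step_prob (o : bool * bool) : R := (if o.1 then q else 1 - q) / 2.
Definition step_val (o : bool * bool) : R := if o.1 then sgnb o.2 else 0.

Definition walk_prob (f : {ffun 'I_m -> bool * bool}) : R :=
  \prod_i step_prob (f i).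
Definition walk_val (f : {ffun 'I_m -> bool * bool}) : R :=
  \sum_i step_val (f i).

Lemma sum_bool2 (F : bool * bool -> R) :
  \sum_o F o = F (true, true) + F (true, false) +
               (F (false, true) + F (false, false)).
Proof.
rewrite (eq_bigr (fun o => F (o.1, o.2))); last by case.
by rewrite -(pair_bigA _ (fun a b => F (a, b))) big_bool !big_bool.
Qed.

Lemma step_moment c : \sum_o step_prob o * step_val o ^+ c =
  if c == 0%N then 1 else if odd c then 0 else q.
Proof.
rewrite sum_bool2 /step_prob /step_val /sgnb /= expr1n -signr_odd.
case: eqP => [->|/eqP/negPf c0]; first by rewrite !expr0; field.
by rewrite expr0n c0; case: (odd c); rewrite /= ?expr1 ?expr0; field.
Qed.

Lemma prod_count (J : finType) (w : seq J) (F : J -> R) :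
  \prod_(i <- w) F i = \prod_i F i ^+ count_mem i w.
Proof.
elim: w => [|j w IH]; first by rewrite big_nil big1 // => i; rewrite expr0.
rewrite big_cons IH /=; under [RHS]eq_bigr => i _ do rewrite exprD.
rewrite big_split /=; congr (_ * _).
rewrite (bigD1 j) //= eqxx expr1 big1 ?mulr1 // => i.
by rewrite eq_sym => /negPf ->.
Qed.

(** Independence factors the expectation into step moments: an absent letter gives 1, an odd
    multiplicity 0, a positive even multiplicity [q]. *)
Lemma walk_word w : \sum_f walk_prob f * \prod_(i <- w) step_val (f i) =
  if even_word w then q ^+ size (undup w) else 0.
Proof.
under eq_bigr => f _ do rewrite prod_count -big_split /=.
rewrite -(bigA_distr_bigA
  (fun i o => step_prob o * step_val o ^+ count_mem i w)).
under eq_bigr => i _ do rewrite step_moment.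
case: ifPn => [/allP ew|/allPn[i iw]]; last first.
  rewrite negbK => ow; rewrite (bigD1 i) //= ow ifN ?mul0r //.
  by apply: contraTneq ow => ->.
rewrite -(card_uniqP (undup_uniq w)) -prodr_const [RHS]big_mkcond /=.
apply: eq_bigr => i _; rewrite mem_undup.
have [iw|/count_memPn -> //] := boolP (i \in w).
rewrite (negPf (ew i iw)) ifN //.
by rewrite -lt0n -has_count has_pred1.
Qed.

Lemma walk_moment p : \sum_f walk_prob f * walk_val f ^+ p =
  wsum p (fun w : seq 'I_m => if even_word w then q ^+ size (undup w) else 0).
Proof.
under eq_bigr => f _ do rewrite /walk_val exp_sum_wsum mulrC wsum_mulr.
rewrite exchange_wsum; apply: eq_wsum => w.
by rewrite -walk_word; apply: eq_bigr => f _; rewrite mulrC.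
Qed.

Lemma walk_exp (x : R) : \sum_f walk_prob f * expR (x * walk_val f) =
  (1 + q * ((expR x + expR (- x)) / 2 - 1)) ^+ m.
Proof.
under eq_bigr => f _ do rewrite /walk_val mulr_sumr expR_sum -big_split /=.
rewrite -(bigA_distr_bigA (fun i o => step_prob o * expR (x * step_val o))).
rewrite prodr_const card_ord; congr (_ ^+ _).
rewrite sum_bool2 /step_prob /step_val /sgnb /= mulr1 mulr0 mulrN1 expR0.
by field.
Qed.

(** The generating function [walk_exp] is even in [x], and $1+y\le e^y$ is applied to each of its
    [m] factors. *)
Lemma walk_cosh (x : R) : 0 <= q <= 1 ->
  \sum_f walk_prob f * (expR (x * walk_val f) + expR (- (x * walk_val f))) <=
  2 * expR (m%:R * q * ((expR x + expR (- x)) / 2 - 1)).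
Proof.
move=> /andP[q0 q1]; under eq_bigr => f _ do rewrite mulrDr -mulNr.
rewrite big_split /= !walk_exp opprK [expR (- x) + _]addrC -mulr2n mulr_natl lerMn2r /=.
rewrite -mulrA expRM_natl lerXn2r ?nnegrE ?expR_ge0 ?expR_ge1Dx //.
(* The base is nonnegative, being $(1-q)+q\cosh x$ with $q\le1$; this permits raising to the power
   [m]. *)
have := expR_gt0 x; have := expR_gt0 (- x); nra.
Qed.

End ScalarWalk.

(** Both sides expand over the same words of length [p], and [sum_wpow_le] compares them word by
    word; the factor ['C(n, l)] is the number of starting vertices. *)
Lemma trace_moment (R : realType) (n k l m p : nat) (q : R) :
  ~~ odd k -> (k %/ 2 <= l)%N -> (k <= n)%N ->
  q = ('C(n - l, k %/ 2) * 'C(l, k %/ 2))%N%:R / 'C(n, k)%:R ->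
  \sum_(Phi : formula n k m) \sum_S mpow (@Mmat R n k m l Phi) p S S <=
  #|{: formula n k m}|%:R * 'C(n, l)%:R *
    \sum_(f : {ffun 'I_m -> bool * bool}) walk_prob q f * walk_val R f ^+ p.
Proof.
move=> ek kl kn qE; rewrite exchange_big -mulrA mulrCA [leRHS]mulr_natl.
rewrite -(card_ksub n l) -sumr_const; apply: ler_sum => S _.
rewrite (eq_bigr (fun Phi : formula n k m =>
  wsum p (fun w => wpow (fun i => cmat R (Phi i)) w S S))); last first.
  by move=> Phi _; rewrite -mpow_wsum.
rewrite exchange_wsum walk_moment mulrC wsum_mulr; apply: ler_wsum => w.
by rewrite mulrC qE sum_wpow_le.
Qed.

(** * Operator norm, certificate and tail bound *)

Section OperatorNorm.
Variables (R : realType) (I : finType).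
Implicit Types (M : I -> I -> R) (v : I -> R).

Lemma mvec_le_opnorm M v : \sum_t v t ^+ 2 <= 1 ->
  Num.sqrt (\sum_s mvec M v s ^+ 2) <= opnorm M.
Proof.
move=> v1; apply: ub_le_sup; last by exists v.
(* The Frobenius norm bounds the set, so the supremum is not a default value. *)
exists (Num.sqrt (\sum_s \sum_t M s t ^+ 2)) => r [u [u1 ->]].
apply: ler_wsqrtr; apply: ler_sum => s _.
rewrite (le_trans (sum_cauchy_schwarz _ _)) // ler_piMr //.
by apply: sumr_ge0 => t _; exact: sqr_ge0.
Qed.

Lemma quad_form_le_opnorm M v : \sum_t v t ^+ 2 <= 1 ->
  \sum_s v s * mvec M v s <= opnorm M.
Proof.
move=> v1; apply: le_trans (mvec_le_opnorm M v1).
have [->|v0] := eqVneq (\sum_s v s * mvec M v s) 0; first exact: sqrtr_ge0.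
apply: le_trans (ler_norm _) _; rewrite -sqrtr_sqr; apply: ler_wsqrtr.
apply: le_trans (sum_cauchy_schwarz _ _) _; rewrite ler_piMl //.
by apply: sumr_ge0 => s _; exact: sqr_ge0.
Qed.

Lemma opnorm_gt M (t : R) : t < opnorm M ->
  exists2 v, \sum_s v s ^+ 2 <= 1 & t < Num.sqrt (\sum_s mvec M v s ^+ 2).
Proof.
move=> tM; have [|r [v [v1 ->]] tr] := sup_gt _ tM; last by exists v.
exists 0, (fun=> 0); split.
  by rewrite big1 // => s _; rewrite expr0n.
rewrite big1 ?sqrtr0 // => s _.
by rewrite big1 ?expr0n // => u _; rewrite mulr0.
Qed.

Lemma opnorm_gt_trace M (t : R) r : (forall s t, M s t = M t s) ->
  0 <= t -> t < opnorm M -> t ^+ (r + r) <= \sum_s mpow M (r + r) s s.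
Proof.
move=> Ms t0 /opnorm_gt[v v1 tv].
case: r => [|r].
  have [s0 _] : exists s : I, v s = v s.
    (* For [r = 0] the claim is that the trace of the identity is at least 1, so an index must
       exist; over an empty type the norm of [v]'s image would be 0, against [0 <= t]. *)
    case: (pickP (@predT I)) => [s _|I0]; first by exists s.
    by move: tv; rewrite big_pred0 // sqrtr0 ltNge t0.
  rewrite expr0 (bigD1 s0) //= eqxx lerDl sumr_ge0 //.
apply: le_trans (sqnorm_exp_le_trace r Ms v1).
rewrite addnn -mul2n exprM lerXn2r ?nnegrE ?sqr_ge0 ?sumr_ge0 // => [s _|].
  exact: sqr_ge0.
rewrite -[leRHS]sqr_sqrtr ?sumr_ge0 // => [|s _]; last exact: sqr_ge0.
by rewrite lerXn2r ?nnegrE ?sqrtr_ge0 // ltW.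
Qed.

Lemma trace_even_ge0 M r : (forall s t, M s t = M t s) ->
  0 <= \sum_s mpow M (r + r) s s.
Proof.
move=> Ms; apply: sumr_ge0 => s _; rewrite mpow_add; apply: sumr_ge0 => u _.
by rewrite (mpow_sym _ u) // -expr2 sqr_ge0.
Qed.

End OperatorNorm.

(** * The deterministic certificate *)

Section Certificate.
Variables (R : realType) (n k l m : nat).
Hypotheses (ek : ~~ odd k) (kl : (k %/ 2 <= l)%N) (lk : (l + k %/ 2 <= n)%N).

Local Notation K := ('C(n, k)%:R : R).
Local Notation N := ('C(n, l)%:R : R).
Local Notation d := (('C(n - l, k %/ 2) * 'C(l, k %/ 2))%N%:R : R).

Lemma Mmat_sym (Phi : formula n k m) S T :
  @Mmat R n k m l Phi S T = @Mmat R n k m l Phi T S.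
Proof. by apply: eq_bigr => i _; exact: (cmat_sym R (Phi i)). Qed.

Lemma d_gt0 : 0 < d.
Proof. by rewrite ltr0n muln_gt0 !bin_gt0 kl leq_subRL ?lk //
  (leq_trans (leq_addr _ _) lk). Qed.

Lemma n_ge_k : (k <= n)%N.
Proof. by move: (even_halfK ek) kl lk; rewrite divn2 -muln2; lia. Qed.

Lemma N_gt0 : 0 < N.
Proof. by rewrite ltr0n bin_gt0 (leq_trans (leq_addr _ _) lk). Qed.

Variables (Phi : formula n k m) (x : 'I_n -> R).
Hypothesis x1 : forall j, x j = 1 \/ x j = -1.

Let chi (S : {set 'I_n}) : R := \prod_(j in S) x j.

Lemma chi_sdiff S T : chi (sdiff S T) = chi S * chi T.
Proof.
rewrite /chi !(big_mkcond (fun j => j \in _)) -big_split /=.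
apply: eq_bigr => j _; rewrite in_sdiff.
have xx : x j * x j = 1 by case: (x1 j) => ->; ring.
by do 2 case: (j \in _); rewrite /= ?mul1r ?mulr1 ?xx.
Qed.

Lemma chi_sign S : chi S = 1 \/ chi S = -1.
Proof.
rewrite /chi; elim/big_ind: _ => [|a b|j _]; [by left| |exact: x1].
by case=> -> [] ->; rewrite ?mulrN1 ?mulr1 ?opprK; [left|right|right|left].
Qed.

Lemma chi_sqr S : chi S ^+ 2 = 1.
Proof. by case: (chi_sign S) => ->; rewrite ?sqrrN expr1n. Qed.

(** Satisfied constraints contribute 1 to the right-hand side and violated ones -1. *)
Lemma Psat_sum : 2 * (Psat Phi x)%:R - m%:R =
  \sum_(i < m) sgnb (Phi i).2 * chi (val (Phi i).1) :> R.
Proof.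
have -> : m%:R = \sum_(i < m) (1 : R) by rewrite sumr_const card_ord.
rewrite /Psat -sum1dep_card natr_sum big_mkcond /= mulr_sumr -sumrB.
apply: eq_bigr => i _.
rewrite -/(chi _) /sgnb; have n1 : (1 == -1 :> R) = false by apply/eqP; lra.
by case: (chi_sign (val (Phi i).1)) => ->; case: (Phi i).2;
  rewrite ?[-1 == 1]eq_sym ?eqxx ?n1; lra.
Qed.

(** On the support of the [i]-th matrix, [chi S * chi T] equals [chi] of the constraint set, so
    every pair counted by [sum_pairs] contributes the same value. *)
Lemma quad_form_chi :
  \sum_(S : ksub n l) \sum_(T : ksub n l)
     chi (val S) * Mmat Phi S T * chi (val T) =
  ('C(k, k %/ 2) * 'C(n - k, l - k %/ 2))%N%:R * (2 * (Psat Phi x)%:R - m%:R).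
Proof.
rewrite Psat_sum mulr_sumr.
under eq_bigr => S _ do under eq_bigr => T _ do
  rewrite /Mmat mulr_sumr mulr_suml.
under eq_bigr => S _ do rewrite exchange_big.
rewrite exchange_big; apply: eq_bigr => i _.
rewrite -(sum_pairs R (Phi i).1 ek kl) mulr_suml; apply: eq_bigr => S _.
rewrite mulr_suml; apply: eq_bigr => T _.
case: eqP => [<-|_]; last by rewrite mulr0 !mul0r.
by rewrite chi_sdiff /=; ring.
Qed.

Lemma certificate : (Psat Phi x)%:R <=
  m%:R / 2 + (2 * d)^-1 * K * opnorm (@Mmat R n k m l Phi).
Proof.
pose v (S : ksub n l) := chi (val S) / Num.sqrt N.
have sN : Num.sqrt N ^+ 2 = N by rewrite sqr_sqrtr // ltW ?N_gt0.
have sNV : N^-1 = (Num.sqrt N)^-1 ^+ 2 by rewrite exprVn sN.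
have v1 : \sum_S v S ^+ 2 <= 1.
  under eq_bigr => S _ do rewrite /v exprMn chi_sqr mul1r exprVn sN.
  by rewrite sumr_const card_ksub -[_ *+ _]mulr_natl mulfV // gt_eqF // N_gt0.
have := quad_form_le_opnorm (@Mmat R n k m l Phi) v1.
(* Normalising divides the quadratic form by [N]; [double_count] then turns the number of pairs over
   [N] into [d / K]. *)
rewrite (_ : \sum_s _ = d / K * (2 * (Psat Phi x)%:R - m%:R)); last first.
  transitivity (N^-1 * \sum_(S : ksub n l) \sum_(T : ksub n l)
     chi (val S) * Mmat Phi S T * chi (val T)).
    rewrite mulr_sumr; apply: eq_bigr => S _; rewrite /mvec !mulr_sumr.
    by apply: eq_bigr => T _; rewrite /v sNV; ring.
  rewrite quad_form_chi mulrA; congr (_ * _).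
  have := double_count n R ek kl; move=> E.
  apply: (mulfI (x := K)); first by rewrite gt_eqF // ltr0n bin_gt0 n_ge_k.
  rewrite mulrCA E; field; rewrite !gt_eqF ?N_gt0 // ltr0n bin_gt0; exact: n_ge_k.
have K0 : 0 < K by rewrite ltr0n bin_gt0 n_ge_k.
have d0 := d_gt0; set o := opnorm _; set P := (Psat _ _)%:R.
rewrite mulrAC ler_pdivrMr //; move: d K K0 d0 => D k0 K0 D0 h.
rewrite -subr_ge0 (_ : _ - P = (o * k0 - D * (2 * P - m%:R)) / (2 * D)).
  by rewrite divr_ge0 ?subr_ge0 // mulr_ge0 // ltW.
by field; rewrite gt_eqF.
Qed.

End Certificate.

(** * The tail bound for the operator norm *)

Section Tail.
Variables (R : realType) (n k l m : nat).
Hypotheses (ek : ~~ odd k) (kl : (k %/ 2 <= l)%N) (lk : (l + k %/ 2 <= n)%N).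

Lemma opnorm_tail (q t x : R) :
  q = ('C(n - l, k %/ 2) * 'C(l, k %/ 2))%N%:R / 'C(n, k)%:R ->
  0 <= q <= 1 -> 0 <= t -> 0 <= x ->
  unif_prob [set Phi : formula n k m | t < opnorm (@Mmat R n k m l Phi)]
    * expR (x * t) <=
  2 * 'C(n, l)%:R * expR (m%:R * q * ((expR x + expR (- x)) / 2 - 1)).
Proof.
move=> qE q01 t0 x0.
have kn := n_ge_k ek kl lk.
set E := [set _ | _]; set P := unif_prob E.
have P0 : 0 <= P by rewrite divr_ge0.
have F0 : 0 < #|{: formula n k m}|%:R :> R.
  rewrite ltr0n card_ffun expn_gt0 card_prod card_ksub card_bool muln_gt0.
  by rewrite bin_gt0 kn.
apply: (@le_trans _ _ (P * (expR (x * t) + expR (- (x * t))))).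
  by rewrite ler_wpM2l // lerDl expR_ge0.
rewrite -mulrA mulrCA.
apply: le_trans (ler_wpM2l (ler0n _ _) (walk_cosh m x q01)).
rewrite mulr_sumr.
rewrite (eq_bigr (fun f : {ffun 'I_m -> bool * bool} => 'C(n, l)%:R * walk_prob q f *
   (expR (x * walk_val R f) + expR (- (x * walk_val R f))))); last first.
  by move=> f _; rewrite mulrA.
apply: cosh_le_of_even_moments => r.
have tr := @trace_moment R n k l m (r + r) q ek kl kn qE.
(* Markov's inequality for the trace: a formula in [E] contributes at least $t^{2r}$, any other a
   nonnegative amount. *)
have bad : #|E|%:R * t ^+ (r + r) <=
    \sum_(Phi : formula n k m) \sum_S mpow (@Mmat R n k m l Phi) (r + r) S S.
  rewrite mulr_natl -sumr_const big_mkcond; apply: ler_sum => Phi _.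
  rewrite inE; case: ifP => [tM|_].
    by apply: opnorm_gt_trace => //; exact: Mmat_sym.
  by apply: trace_even_ge0; exact: Mmat_sym.
have {tr bad} h := le_trans bad tr.
rewrite exprMn (_ : P * _ =
  x ^+ (r + r) * (#|E|%:R * t ^+ (r + r) / #|{: formula n k m}|%:R)).
  2: by rewrite /P /unif_prob; ring.
rewrite [leRHS](_ : _ = x ^+ (r + r) * ('C(n, l)%:R *
   \sum_(f : {ffun 'I_m -> bool * bool}) walk_prob q f * walk_val R f ^+ (r + r))).
  2: by rewrite !mulr_sumr; apply: eq_bigr => f _; rewrite exprMn; ring.
rewrite ler_wpM2l ?exprn_ge0 // ler_pdivrMr //.
by rewrite [leRHS]mulrC mulrA.
Qed.

(** For each [S], every constraint has at most one edge at [S]; summing over all constraints gives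
    $2d\le2K$. *)
Lemma edge_prob_le1 :
  (('C(n - l, k %/ 2) * 'C(l, k %/ 2))%N%:R / 'C(n, k)%:R : R) <= 1.
Proof.
rewrite ler_pdivrMr ?mul1r; last by rewrite ltr0n bin_gt0 (n_ge_k ek kl lk).
rewrite -(ler_pM2l (ltr0n R 2)) -(ler_pM2l (N_gt0 R lk)).
rewrite -(card_constraint R n k) -(card_ksub n l) [leLHS]mulr_natl [leRHS]mulr_natl.
rewrite -sumr_const -[leRHS]sumr_const.
apply: ler_sum => S _; rewrite -(sum_cmat R ek kl S) -sumr_const.
by apply: ler_sum => a _; exact: row_cmat_le1.
Qed.

Lemma opnorm_tail_le (beta : R) : 0 < beta < 1 ->
  m%:R >= 4 * expR 1 ^+ 2 * 'C(n, k)%:R * ln ('C(n, l)%:R) /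
    (beta ^+ 2 * ('C(n - l, k %/ 2) * 'C(l, k %/ 2))%N%:R) ->
  unif_prob [set Phi : formula n k m |
    beta * m%:R * (('C(n - l, k %/ 2) * 'C(l, k %/ 2))%N%:R / 'C(n, k)%:R)
      < opnorm (@Mmat R n k m l Phi)] <= 2 / 'C(n, l)%:R :> R.
Proof.
move=> /andP[b0 b1].
have d0 := d_gt0 R kl lk; have N0 := N_gt0 R lk.
have K0 : 0 < 'C(n, k)%:R :> R by rewrite ltr0n bin_gt0 (n_ge_k ek kl lk).
have q1 := edge_prob_le1; set q := _ / 'C(n, k)%:R in q1 *.
have q0 : 0 < q by rewrite divr_gt0.
have L0 : 0 <= ln ('C(n, l)%:R : R).
  by rewrite ln_ge0 // ler1n -(ltr0n R).
have e2 : 2 <= expR 1 :> R by apply: le_trans (expR_ge1Dx 1); rewrite -natr1.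
rewrite ler_pdivrMr ?mulr_gt0 ?exprn_gt0 // => hm.
(* The constant 16 comes from $4e^2\ge16$. *)
have hl : 16 * ln 'C(n, l)%:R <= m%:R * q * beta ^+ 2.
  rewrite /q -(ler_pM2r K0) [leRHS](_ : _ = m%:R * (beta ^+ 2 *
    ('C(n - l, k %/ 2) * 'C(l, k %/ 2))%N%:R)).
    apply: le_trans hm; have e4 : 0 <= expR 1 ^+ 2 - 4 :> R by nra.
    by have := mulr_ge0 e4 (mulr_ge0 (ltW K0) L0); lra.
  move: (_%:R) d0 K0 => D; move: ('C(n, k)%:R : R) => k0 _ K0.
  by field; rewrite gt_eqF.
have x01 : 0 <= beta / 2 < 1 by apply/andP; split; lra.
have t0 : 0 <= beta * m%:R * q by rewrite !mulr_ge0 // ltW.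
have q01 : 0 <= q <= 1 by rewrite ltW.
have x0 : 0 <= beta / 2 by case/andP: x01.
have := opnorm_tail (erefl q) q01 t0 x0.
set P := unif_prob _ => tail.
have mq0 : 0 <= m%:R * q by rewrite mulr_ge0 // ltW.
(* At $x=\beta/2$, [cosh_le] gives $\beta^2/(4-\beta^2)$, and $\beta^2\le1$. *)
have cosh : (expR (beta / 2) + expR (- (beta / 2))) / 2 - 1 <= beta ^+ 2 / 3.
  have h : (beta / 2) ^+ 2 / (1 - (beta / 2) ^+ 2) <= beta ^+ 2 / 3.
    have bb0 := sqr_ge0 beta; have bb1 : beta ^+ 2 <= 1 by nra.
    rewrite expr_div_n (_ : 2 ^+ 2 = 4 :> R); last by ring.
    by move: (beta ^+ 2) bb0 bb1 => z z0 z1; rewrite ler_pdivrMr; nra.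
  have := cosh_le x01; rewrite -mulrA; lra.
(* The gap $mq\beta^2(1/2-1/3)$ is at least $(16/6)\log\binom n\ell$; saving $2\log\binom n\ell$
   turns the prefactor $2\binom n\ell$ into $2/\binom n\ell$. *)
have {cosh} expo : m%:R * q * ((expR (beta / 2) + expR (- (beta / 2))) / 2 - 1)
    <= beta / 2 * (beta * m%:R * q) - 2 * ln 'C(n, l)%:R.
  apply: le_trans (ler_wpM2l mq0 cosh) _.
  rewrite (_ : beta / 2 * (beta * m%:R * q) = m%:R * q * beta ^+ 2 / 2).
    by rewrite mulrA; lra.
  by ring.
move: expo; rewrite -ler_expR expRD [expR (- (2 * _))]expRN.
rewrite expRM_natl lnK ?posrE // => expo.
have N2 : 0 <= 2 * 'C(n, l)%:R :> R by rewrite mulr_ge0.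
have {tail expo} := le_trans tail (ler_wpM2l N2 expo).
move: (expR (_ * (beta * _ * q))) (expR_gt0 (beta / 2 * (beta * m%:R * q))) => e e0.
rewrite [leRHS](_ : _ = 2 / 'C(n, l)%:R * e); first by rewrite ler_pM2r.
by move: ('C(n, l)%:R : R) N0 => N N0; field; rewrite gt_eqF.
Qed.

End Tail.

Theorem theorem6 (R : realType) (n k l m : nat) (beta : R) :
  (2 <= k)%N -> ~~ odd k ->
  (k %/ 2 <= l)%N -> (l <= n - k %/ 2)%N ->
  0 < beta < 1 ->
  let d := ('C(n - l, k %/ 2) * 'C(l, k %/ 2))%N in
  m%:R >= 4 * expR 1 ^+ 2 * 'C(n, k)%:R * ln ('C(n, l)%:R) / (beta ^+ 2 * d%:R) ->
  (* deterministic certificate: for every formula, the LHS bounds max_x P_Phi(x) *)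
  (forall (Phi : formula n k m) (x : 'I_n -> R),
      (forall j, x j = 1 \/ x j = -1) ->
      (Psat Phi x)%:R <=
        m%:R / 2 + (2 * d%:R)^-1 * 'C(n, k)%:R * opnorm (@Mmat R n k m l Phi)) /\
  (* high-probability bound over a uniformly random formula *)
  @unif_prob R _ [set Phi : formula n k m |
     m%:R / 2 + (2 * d%:R)^-1 * 'C(n, k)%:R * opnorm (@Mmat R n k m l Phi)
       <= m%:R / 2 * (1 + beta)]
    >= 1 - 3 / 'C(n, l)%:R.
Proof.
move=> k2 ek kl ln b01 d hm.
have lk : (l + k %/ 2 <= n)%N.
  (* The subtraction in [l <= n - k %/ 2] is truncated; positivity of [k %/ 2], hence of [l],
     excludes the truncated case. *)
  have h : (0 < k %/ 2)%N by rewrite divn_gt0.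
  lia.
split=> [Phi x x1|]; first exact: certificate.
have tail := opnorm_tail_le ek kl lk b01 hm.
have d0 : 0 < d%:R :> R := d_gt0 R kl lk.
have kn := n_ge_k ek kl lk.
have K0 : 0 < 'C(n, k)%:R :> R by rewrite ltr0n bin_gt0.
have N0 := N_gt0 R lk.
set B := [set Phi | _ < _] in tail.
(* After clearing denominators, the desired inequality says exactly that the norm is at most $\beta
   m d/K$. *)
rewrite (_ : [set Phi | _] = ~: B); last first.
  apply/setP => Phi; rewrite !inE -leNgt; move: (opnorm _) => o.
  have d20 : 0 < 2 * d%:R :> R by rewrite mulr_gt0.
  rewrite -subr_ge0 -[RHS]subr_ge0 -/d.
  rewrite -[RHS](pmulr_rge0 _ K0) -[LHS](pmulr_rge0 _ d20); congr (0 <= _).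
  move: (d%:R : R) d0 ('C(n, k)%:R : R) K0 => D D0 k0 K0.
  by field; rewrite !gt_eqF.
rewrite /unif_prob cardsCs finset.setCK natrB ?max_card //.
rewrite mulrBl divff; last first.
  rewrite pnatr_eq0 -lt0n card_ffun expn_gt0 card_prod card_ksub card_bool.
  by rewrite muln_gt0 bin_gt0 kn.
rewrite lerD2l lerN2; apply: le_trans tail _.
by rewrite ler_pM2r ?invr_gt0 // ler_nat.
Qed.
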